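(* Let $P$ be a lattice polytope of dimension $n$, and let $r(P)$ be the largest integer such that $r(P)\,P$ does not contain any lattice points in its interior. Then the polytope $\bigl(n-r(P)\bigr)P$ is normal.
   Context: A lattice polytope is the convex hull of finitely many points of a lattice. A lattice polytope $P$ is normal if for every integer $m\geq 1$ every lattice point in $mP$ is a sum of $m$ lattice points in $P$. Interior means relative interior (the usual interior when $P$ is full-dimensional). By convention $r(P)=0$ if $P$ itself contains a lattice point in its interior; so $r(P)$ is the largest integer $r\geq 0$ such that none of $P,2P,\dotsc,rP$ has an interior lattice point. *)

(* Defs.v *)
From mathcomp Require Import all_boot all_order all_algebra.
From mathcomp Require Import all_classical all_reals all_analysis.

Set Implicit Arguments.
Unset Strict Implicit.
Unset Printing Implicit Defensive.

Import Order.TTheory GRing.Theory Num.Theory.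
Import numFieldNormedType.Exports.

Local Open Scope classical_set_scope.
Local Open Scope ring_scope.

Section LatticePolytopes.
Context {R : realType} {d : nat}.
Implicit Types (L S P : set 'rV[R]_d).

(* L is the Z-span of R-linearly independent vectors, the rows of B;
   the rank k of L may be smaller than d. *)
Definition is_lattice L : Prop :=
  exists (k : nat) (B : 'M[R]_(k, d)), row_free B /\
    L = [set map_mx intr z *m B | z in [set: 'rV[int]_k]].

Definition convex_hull S : set 'rV[R]_d := smallest (@convex_set R 'rV[R]_d) S.

Definition affine_set S : Prop :=
  forall (x y : 'rV[R]_d) (t : R), S x -> S y -> S ((1 - t) *: x + t *: y).

Definition affine_hull S : set 'rV[R]_d := smallest affine_set S.

(* The affine hull is a translate of an n-dimensional linear subspace
   (in particular S is nonempty). *)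
Definition has_dim S (n : nat) : Prop :=
  exists (x : 'rV[R]_d) (U : {vspace 'rV[R]_d}),
    \dim U = n /\ affine_hull S = [set x + u | u in [set` U]].

Definition relint S : set 'rV[R]_d :=
  [set x | S x /\ \forall y \near within (affine_hull S) (nbhs x), S y].

Definition lattice_polytope L P : Prop :=
  exists V : set 'rV[R]_d, [/\ finite_set V, V `<=` L & P = convex_hull V].

Definition dilate (m : nat) P : set 'rV[R]_d := [set m%:R *: x | x in P].

Definition normal_polytope L P : Prop :=
  forall (m : nat) (x : 'rV[R]_d), (1 <= m)%N -> L x -> dilate m P x ->
    exists y : 'I_m -> 'rV[R]_d,
      (forall i, L (y i) /\ P (y i)) /\ x = \sum_(i < m) y i.

(* The dilate 0P is left out: its relative interior is always {0}. *)
Definition no_interior_upto L P (r : nat) : Prop :=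
  forall k : nat, (1 <= k <= r)%N -> L `&` relint (dilate k P) = set0.

Definition largest (A : set nat) (r : nat) : Prop :=
  A r /\ forall s, A s -> (s <= r)%N.

(* The default value 0 is irrelevant: for a lattice polytope P of dimension n
   the maximum exists and is at most n, because (n+1)P contains a lattice point
   in its relative interior. *)
Definition rpoly L P : nat := xget 0%N (largest (no_interior_upto L P)).

End LatticePolytopes.

(* Main.v *)
(** Write a lattice point of mkP, with k = n - r(P), as a nonnegative combination
    of n+1 affinely independent vertices (Caratheodory), and split each coefficient
    into its integral and fractional part.  The fractional parts add up to an
    integer s and give a lattice point y of sP.  Replacing every fractional part by
    its complement to 1 gives a lattice point in the interior of (n+1-s)P, so
    n+1-s > r(P), that is s <= k.  The point is thus y plus mk-s vertices: group
    k-s of them with y, and the remaining ones k at a time.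

    Points of P are handled through their lifts (v, 1), which turn affine
    independence and convex combinations into freeness and cones. *)
Require Import Defs.
From mathcomp Require Import all_boot all_order all_algebra.
From mathcomp Require Import all_classical all_reals all_analysis.
From mathcomp Require Import lra zify.

Set Implicit Arguments.
Unset Strict Implicit.
Unset Printing Implicit Defensive.

Import Order.TTheory GRing.Theory Num.Theory.
Import numFieldNormedType.Exports.

Local Open Scope classical_set_scope.
Local Open Scope ring_scope.

(** * Linear algebra and conic Caratheodory *)

Lemma span_coef (K : fieldType) (vT : vectType K) (s : seq vT) (v : vT) :
  uniq s -> v \in span s -> exists a : vT -> K, v = \sum_(w <- s) a w *: w.
Proof.
elim: s v => [|u s IH] v.
  by rewrite span_nil memv0 => _ /eqP ->; exists (fun=> 0); rewrite big_nil.
rewrite span_cons => /= /andP[us uq] /memv_addP[_ /vlineP[k ->] [z /(IH _ uq)[a ->] ->]].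
exists (fun w => if w == u then k else a w).
rewrite big_cons eqxx; congr (_ + _); apply: eq_big_seq => w ws.
by case: eqP => // wu; rewrite -wu ws in us.
Qed.

Lemma not_free_rem (K : fieldType) (vT : vectType K) (s : seq vT) :
  uniq s -> ~~ free s -> exists2 v, v \in s & v \in <<rem v s>>%VS.
Proof.
(* A non-free list has an entry in the span of the later ones; by [uq] these survive the removal of
   that entry. *)
move=> uq; rewrite -[s]/(val (in_tuple s)) freeNE => /existsP[i /= vi].
exists s`_i; first exact: mem_nth.
apply: subvP vi; apply: sub_span => w wd.
have := uq; rewrite -{1}(cat_take_drop i s) (drop_nth 0) // cat_uniq /=.
move=> /and4P[_ _ nd _].
rewrite mem_rem_uniq // !inE (mem_drop wd) andbT.
by apply: contraNneq nd => <-.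
Qed.

Lemma exists_argmin (R : realDomainType) (T : eqType) (s : seq T) (p : pred T)
    (f : T -> R) : has p s ->
  exists v, [/\ v \in s, p v & {in s, forall w, p w -> f v <= f w}].
Proof.
elim: s => //= u s IH; have [/IH[v [vs pv vmin]] _|nps] := boolP (has p s).
- have [pu|npu] := boolP (p u); last first.
    exists v; split; rewrite ?inE ?vs ?orbT // => w; rewrite inE => /predU1P[->|/vmin//].
    by rewrite (negbTE npu).
  have [fuv|fvu] := lerP (f u) (f v).
    exists u; split; rewrite ?inE ?eqxx // => w; rewrite inE => /predU1P[->//|/vmin + pw].
    by move=> /(_ pw); apply: le_trans.
  exists v; split; rewrite ?inE ?vs ?orbT // => w; rewrite inE => /predU1P[->|/vmin//].
  by move=> _; apply: ltW.
- rewrite orbF => pu; exists u; split; rewrite ?inE ?eqxx // => w.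
  rewrite inE => /predU1P[->//|ws pw].
  by move/hasPn/(_ _ ws): nps; rewrite pw.
Qed.

(** While [s] is dependent, a multiple of a linear relation is subtracted until one coefficient
    vanishes, and that vector is dropped. Vectors with coefficient zero are otherwise kept, so [b]
    still spans all of [span s]; this is what later gives a point in the relative interior. *)
Lemma conic_caratheodory (R : realFieldType) (vT : vectType R) (s : seq vT)
    (c : vT -> R) : uniq s -> {in s, forall v, 0 <= c v} ->
  exists (b : seq vT) (e : vT -> R),
    [/\ basis_of (span s) b, {subset b <= s}, {in b, forall v, 0 <= e v} &
      \sum_(v <- s) c v *: v = \sum_(v <- b) e v *: v].
Proof.
move: {2}(size s) (erefl (size s)) => N.
elim: N s c => [|N IH] s c sN uq c0.
  exists s, c; split => //; rewrite basisEdim subvv /=.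
  by rewrite (size0nil sN) span_nil dimv0.
have [fs|] := boolP (free s); first by exists s, c; split => //; rewrite /basis_of eqxx.
move=> /(not_free_rem uq)[v vs /(span_coef (rem_uniq _ uq))[a va]].
(* The coefficients of a linear relation on [s], normalised at [v] so that at least one is
   positive. *)
pose mu w := if w == v then 1 else - a w.
have summu : \sum_(w <- s) mu w *: w = 0.
  rewrite (perm_big _ (perm_to_rem vs)) big_cons {1}/mu eqxx scale1r.
  suff : \sum_(w <- rem v s) mu w *: w = - v by move=> ->; apply: addrN.
  rewrite [in RHS]va -sumrN; apply: eq_big_seq => w.
  by rewrite mem_rem_uniq // /mu inE => /andP[/negbTE -> _]; rewrite scaleNr.
(* The least ratio [c w / mu w] over positive [mu w] is the largest [t] for which all
   [c w - t * mu w] stay nonnegative; at [w0] the difference is zero. *)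
have [|w0 [w0s mu0 w0min]] :=
  @exists_argmin _ _ s (fun w => 0 < mu w) (fun w => c w / mu w).
  by apply/hasP; exists v; rewrite // /mu eqxx.
pose t := c w0 / mu w0; pose e w := c w - t * mu w.
have t0 : 0 <= t by rewrite divr_ge0 ?c0 // ltW.
have e0 : {in s, forall w, 0 <= e w}.
  move=> w ws; rewrite /e subr_ge0; have [muw|muw] := ltP 0 (mu w).
    by rewrite -ler_pdivlMr //; apply: w0min.
  by rewrite (le_trans _ (c0 _ ws)) // mulr_ge0_le0.
have ew0 : e w0 = 0 by rewrite /e /t divfK ?subrr // gt_eqF.
have sume : \sum_(w <- s) c w *: w = \sum_(w <- rem w0 s) e w *: w.
  have <- : \sum_(w <- s) e w *: w = \sum_(w <- s) c w *: w.
    transitivity (\sum_(w <- s) c w *: w - t *: \sum_(w <- s) mu w *: w).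
      rewrite scaler_sumr -sumrB; apply: eq_bigr => w _.
      by rewrite scalerA -scalerBl.
    by rewrite summu scaler0 subr0.
  by rewrite (perm_big _ (perm_to_rem w0s)) big_cons /= ew0 scale0r add0r.
(* Since [mu w0] is nonzero, the relation expresses [w0] through the other vectors. *)
have spans : span (rem w0 s) = span s.
  rewrite (eq_span (perm_mem (perm_to_rem w0s))) span_cons; apply/esym/addv_idPr.
  rewrite -memvE; move: summu; rewrite (perm_big _ (perm_to_rem w0s)) big_cons.
  move/eqP; rewrite addr_eq0 => /eqP/(congr1 (fun x => (mu w0)^-1 *: x)).
  rewrite scalerA mulVf ?gt_eqF // scale1r => w0E.
  rewrite [X in X \in _]w0E memvZ // memvN.
  rewrite big_seq; apply: memv_suml => w ws. exact/memvZ/memv_span.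
have [|||b [g [bb bs g0 sumg]]] := IH (rem w0 s) e.
- by rewrite size_rem // sN.
- exact: rem_uniq.
- by move=> w /mem_rem/e0.
exists b, g; split => //; first by rewrite -spans.
- by move=> w /bs/mem_rem.
- by rewrite sume.
Qed.

(** * Convex sets, dilates and lattice sums *)

(** Keeping the total weight as a factor avoids normalisation and covers total weight zero, where
    any point of [C] serves. *)
Lemma convex_comb (R : realType) (d : nat) (C : set 'rV[R]_d) (a b : R) p q :
  convex_set C -> 0 <= a -> 0 <= b -> C p -> C q ->
  exists2 r, C r & a *: p + b *: q = (a + b) *: r.
Proof.
move=> cC a0 b0 Cp Cq; have [ab0|ab0] := eqVneq (a + b) 0.
  move/eqP: ab0; rewrite paddr_eq0 // => /andP[/eqP-> /eqP->].
  by exists p => //; rewrite (addr0 (0 : R)) !scale0r addr0.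
have ab : 0 < a + b by rewrite lt_neqAle eq_sym ab0 addr_ge0.
have t0 : 0 <= a / (a + b) by rewrite divr_ge0 // ltW.
have t1 : a / (a + b) <= 1 by rewrite ler_pdivrMr // mul1r lerDl.
have /set_mem := cC p q (Itv01 t0 t1) (mem_set Cp) (mem_set Cq).
set r := conv _ _ _ => Cr; exists r => //.
rewrite /r /conv /= /unstable.onem scalerDr !scalerA mulrBr mulr1 mulrC divfK //.
by rewrite addrAC subrr add0r.
Qed.

Lemma convex_setP (R : realType) (d : nat) (C : set 'rV[R]_d) :
  (forall p q t, C p -> C q -> 0 <= t -> t <= 1 -> C (t *: p + (1 - t) *: q)) ->
  convex_set C.
Proof.
move=> H p q t /set_mem Cp /set_mem Cq; apply/mem_set.
by rewrite /conv /= /unstable.onem; apply: H.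
Qed.

Lemma convex_sum (R : realType) (d : nat) (C : set 'rV[R]_d) (I : eqType)
    (b : seq I) (g : I -> R) (F : I -> 'rV[R]_d) : convex_set C -> C !=set0 ->
  {in b, forall i, 0 <= g i} -> {in b, forall i, C (F i)} ->
  exists2 r, C r & \sum_(i <- b) g i *: F i = (\sum_(i <- b) g i) *: r.
Proof.
move=> cC [p Cp]; elim: b => [|i b IH] g0 CF.
  by exists p; rewrite // !big_nil scale0r.
have sub j : j \in b -> j \in i :: b by rewrite inE orbC => ->.
have [j /sub/g0//|j /sub/CF//|r Cr er] := IH.
rewrite !big_cons er; apply: convex_comb => //.
- by rewrite g0 // mem_head.
- by rewrite big_seq sumr_ge0 // => j /sub/g0.
- by apply: CF; rewrite mem_head.
Qed.

Lemma convex_hull_convex (R : realType) (d : nat) (S : set 'rV[R]_d) :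
  convex_set (convex_hull S).
Proof.
apply: convex_setP => p q t hp hq t0 t1 C [cC SC].
have Cp : C p by apply: hp.
have Cq : C q by apply: hq.
have /set_mem := cC p q (Itv01 t0 t1) (mem_set Cp) (mem_set Cq).
by [].
Qed.

Lemma dilateD (R : realType) (d a b : nat) (P : set 'rV[R]_d) p q :
  convex_set P -> dilate a P p -> dilate b P q -> dilate (a + b) P (p + q).
Proof.
move=> cP [u Pu <-] [v Pv <-].
have [r Pr ->] := convex_comb cP (ler0n R a) (ler0n R b) Pu Pv.
by exists r; rewrite // natrD.
Qed.

Lemma dilate_sum (R : realType) (d : nat) (P : set 'rV[R]_d) (w : seq 'rV[R]_d) :
  convex_set P -> P !=set0 -> {in w, forall v, P v} ->
  dilate (size w) P (\sum_(v <- w) v).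
Proof.
move=> cP [p Pp]; elim: w => [|v w IH] Pw.
  by exists p; rewrite // big_nil scale0r.
rewrite big_cons; apply: (@dilateD _ _ 1) => //.
  by exists v; rewrite ?scale1r //; apply: Pw; rewrite mem_head.
by apply: IH => u uw; apply: Pw; rewrite inE uw orbT.
Qed.

Lemma lattice0B (R : realType) (d : nat) (L : set 'rV[R]_d) :
  is_lattice L -> L 0 /\ forall x y, L x -> L y -> L (x - y).
Proof.
move=> [k [B [_ ->]]]; split.
  by exists 0 => //; rewrite map_mx0 mul0mx.
move=> _ _ [y _ <-] [z _ <-]; exists (y - z) => //.
by rewrite map_mxB mulmxBl.
Qed.

Lemma lattice_sum (R : realType) (d : nat) (L : set 'rV[R]_d) (w : seq 'rV[R]_d) :
  is_lattice L -> {in w, forall v, L v} -> L (\sum_(v <- w) v).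
Proof.
move=> /lattice0B[L0 LB]; elim: w => [|v w IH] Lw; first by rewrite big_nil.
rewrite big_cons -[v]opprK addrC; apply: (LB).
  by apply: IH => u uw; apply: Lw; rewrite inE uw orbT.
by rewrite -sub0r; apply: LB => //; apply: Lw; rewrite mem_head.
Qed.

Lemma lattice_add (R : realType) (d : nat) (L : set 'rV[R]_d) x y :
  is_lattice L -> L x -> L y -> L (x + y).
Proof.
move=> hL Lx Ly; have := @lattice_sum _ _ _ [:: x; y] hL.
rewrite big_cons big_seq1; apply => u; rewrite !inE => /orP[] /eqP -> //.
Qed.

(** The first summand takes [y] and [k - s] of the vectors; the rest is the same problem with one
    summand fewer and [y] replaced by 0, a point of [dilate 0 P]. *)
Lemma dilate_regroup (R : realType) (d : nat) (L P : set 'rV[R]_d) (k m s : nat) y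
    (w : seq 'rV[R]_d) : is_lattice L -> convex_set P -> P !=set0 ->
  (s <= k)%N -> L y -> dilate s P y -> {in w, forall v, L v /\ P v} ->
  (s + size w = m.+1 * k)%N ->
  exists z : 'I_m.+1 -> 'rV[R]_d,
    (forall i, L (z i) /\ dilate k P (z i)) /\ y + \sum_(v <- w) v = \sum_i z i.
Proof.
move=> hL cP P0; elim: m s y w => [|m IH] s y w sk Ly Py LPw sz.
  exists (fun=> y + \sum_(v <- w) v); split; last by rewrite big_ord1.
  have Lw : {in w, forall v, L v} by move=> v /LPw[].
  have Pw : {in w, forall v, P v} by move=> v /LPw[].
  move=> _; split; first by apply: lattice_add => //; apply: lattice_sum.
  by rewrite -[k]mul1n -sz; apply: dilateD => //; apply: dilate_sum.
pose w1 := take (k - s) w; pose w2 := drop (k - s) w.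
have w12 : w1 ++ w2 = w by apply: cat_take_drop.
have LPw1 : {in w1, forall v, L v /\ P v} by move=> v /mem_take/LPw.
have LPw2 : {in w2, forall v, L v /\ P v} by move=> v /mem_drop/LPw.
(* At least two groups remain, so [w] has at least [k - s] elements. *)
have sz1 : size w1 = (k - s)%N by rewrite size_takel; nia.
have sz2 : (0 + size w2 = m.+1 * k)%N by rewrite size_drop; nia.
have [p Pp] := P0.
have P00 : dilate 0 P 0 by exists p; rewrite // scale0r.
have [z [zP zE]] := IH 0%N 0 w2 (leq0n _) (lattice0B hL).1 P00 LPw2 sz2.
exists (fun i => if unlift ord0 i is Some j then z j else y + \sum_(v <- w1) v).
split.
  move=> i; case: unliftP => [j _|_]; first exact: zP.
  have Lw : {in w1, forall v, L v} by move=> v /LPw1[].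
  have Pw : {in w1, forall v, P v} by move=> v /LPw1[].
  split; first by apply: lattice_add => //; apply: lattice_sum.
  by rewrite -(subnKC sk) -sz1; apply: dilateD => //; apply: dilate_sum.
rewrite big_ord_recl unlift_none -w12 big_cat /= addrA; congr (_ + _).
rewrite -[LHS]add0r zE; apply: eq_bigr => i _.
by rewrite liftK.
Qed.

(** * Lifts, cones and relative interiors *)

(** The height [a] records the dilation factor: for a nonempty polytope [P], the points of
    [dilate k P] are those whose lift at height [k] lies in the cone over the lifts of [P] at height
    1. *)
Definition homog (R : realType) (d : nat) (a : R) (v : 'rV[R]_d) : 'rV[R]_(d + 1) :=
  row_mx v a%:M.

Lemma homog_inj (R : realType) (d : nat) (a b : R) (v w : 'rV[R]_d) :
  homog a v = homog b w -> a = b /\ v = w.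
Proof.
by move/eq_row_mx => [-> /matrixP/(_ 0 0)]; rewrite !mxE eqxx !mulr1n.
Qed.

Lemma homogD (R : realType) (d : nat) (a b : R) (v w : 'rV[R]_d) :
  homog a v + homog b w = homog (a + b) (v + w).
Proof. by rewrite /homog add_row_mx -raddfD. Qed.

Lemma homogZ (R : realType) (d : nat) (c a : R) (v : 'rV[R]_d) :
  c *: homog a v = homog (c * a) (c *: v).
Proof. by rewrite /homog scale_row_mx scale_scalar_mx. Qed.

Lemma homog_sum (R : realType) (d : nat) (I : Type) (b : seq I) (a : I -> R)
    (F : I -> 'rV[R]_d) :
  \sum_(i <- b) homog (a i) (F i) = homog (\sum_(i <- b) a i) (\sum_(i <- b) F i).
Proof.
elim: b => [|i b IH]; last by rewrite !big_cons IH homogD.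
by rewrite !big_nil /homog raddf0 row_mx0.
Qed.

Lemma homog_comb (R : realType) (d : nat) (s : seq 'rV[R]_d)
    (b : seq 'rV[R]_(d + 1)) (g : 'rV[R]_(d + 1) -> R) :
  {subset b <= map (homog 1) s} ->
  \sum_(w <- b) g w *: w =
    homog (\sum_(w <- b) g w) (\sum_(w <- b) g w *: lsubmx w).
Proof.
move=> bs; rewrite -homog_sum; apply: eq_big_seq => w /bs/mapP[v _ ->].
by rewrite homogZ mulr1 row_mxKl.
Qed.

(** The points with such a representation form a convex set containing [s], hence containing the
    smallest one. *)
Lemma hull_cone (R : realType) (d : nat) (s : seq 'rV[R]_d) p :
  convex_hull [set` s] p ->
  exists c : 'rV[R]_(d + 1) -> R, (forall w, 0 <= c w) /\
    homog 1 p = \sum_(w <- undup (map (homog 1) s)) c w *: w.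
Proof.
set h := undup _.
pose C := [set p | exists c : 'rV[R]_(d + 1) -> R,
  (forall w, 0 <= c w) /\ homog 1 p = \sum_(w <- h) c w *: w].
apply: (smallest_sub (X := C)).
  apply: convex_setP => x y t [c [c0 cE]] [e [e0 eE]] t0 t1.
  exists (fun w => t * c w + (1 - t) * e w); split.
    by move=> w; rewrite addr_ge0 // mulr_ge0 // subr_ge0.
  transitivity (t *: homog 1 x + (1 - t) *: homog 1 y).
    by rewrite !homogZ homogD !mulr1 addrCA subrr addr0.
  rewrite cE eE !scaler_sumr -big_split; apply: eq_bigr => w _ /=.
  by rewrite !scalerA -scalerDl.
move=> v /= vs; exists (fun w => (w == homog 1 v)%:R); split => [w|]; first exact: ler0n.
have hv : homog 1 v \in h by rewrite mem_undup map_f.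
rewrite (bigD1_seq (homog 1 v)) ?undup_uniq //= eqxx scale1r big1 ?addr0 //.
by move=> w /negbTE ->; rewrite scale0r.
Qed.

(** Comparing heights forces [a] to be the sum of the weights. Nonemptiness of the hull supplies [r]
    when [b] is empty. *)
Lemma cone_hull (R : realType) (d : nat) (s : seq 'rV[R]_d)
    (b : seq 'rV[R]_(d + 1)) (g : 'rV[R]_(d + 1) -> R) (a : R) q :
  convex_hull [set` s] !=set0 -> {subset b <= map (homog 1) s} ->
  {in b, forall w, 0 <= g w} -> homog a q = \sum_(w <- b) g w *: w ->
  exists2 r, convex_hull [set` s] r & a *: r = q.
Proof.
move=> s0 bs g0; rewrite (homog_comb _ bs) => /homog_inj[-> ->].
have [|r Pr ->] := convex_sum (@convex_hull_convex _ _ [set` s]) s0 g0 (F := lsubmx).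
  move=> w /bs/mapP[v vs ->]; rewrite row_mxKl.
  exact: sub_gen_smallest.
by exists r.
Qed.

(** The points whose lift at height [k] lies in a given linear subspace form an affine set. *)
Lemma affine_hull_dilate (R : realType) (d k : nat) (s : seq 'rV[R]_d) y :
  affine_hull (dilate k (convex_hull [set` s])) y ->
  homog k%:R y \in span (undup (map (homog 1) s)).
Proof.
set W := span _; apply: (smallest_sub (X := [set y | homog k%:R y \in W])).
  move=> u v t /= uW vW.
  have -> : homog k%:R ((1 - t) *: u + t *: v) =
      (1 - t) *: homog k%:R u + t *: homog k%:R v.
    by rewrite !homogZ homogD -mulrDl subrK mul1r.
  by rewrite memvD // memvZ.
move=> _ [p /hull_cone[c [_ pE]] <-] /=.
have -> : homog k%:R (k%:R *: p) = k%:R *: homog 1 p by rewrite homogZ mulr1.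
rewrite pE memvZ // big_seq; apply: memv_suml => w wW.
exact/memvZ/memv_span.
Qed.

Lemma homog_functional_continuous (R : realType) (d : nat) (k : R)
    (f : {linear 'rV[R]_(d + 1) -> R^o}) :
  continuous (fun y : 'rV[R]_d => f (homog k y) : R).
Proof.
(* Expanding [y] in the standard basis exhibits an affine function of its coordinates. *)
have -> : (fun y : 'rV[R]_d => f (homog k y) : R) =
    (fun y => f (homog k 0) + \sum_j y 0 j * f (homog 0 (delta_mx 0 j))).
  apply: funext => y.
  have -> : homog k y = homog k 0 + \sum_j y 0 j *: homog 0 (delta_mx 0 j).
    under eq_bigr do rewrite homogZ.
    rewrite homog_sum homogD add0r -row_sum_delta big1 ?addr0 // => j _.
    by rewrite mulr0.
  by rewrite raddfD raddf_sum; congr (_ + _); apply: eq_bigr => j _; exact: linearZ_LR.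
pose a j : R := f (homog 0 (delta_mx 0 j)).
have hs : continuous (fun y : 'rV[R]_d => \sum_j y 0 j * a j : R^o).
  apply: (@continuous_big R^o _ +%R 0 xpredT) => [|j _ y].
    exact: add_continuous.
  exact: (cvgM (@coord_continuous R 1 d 0 j y) (cvg_cst (a j))).
move=> y; exact: (cvgD (cvg_cst (f (homog k 0) : R^o)) (hs y)).
Qed.

(** The coordinates of the lift in the basis [b] are continuous and positive at [q], hence positive
    nearby. A nearby point of the affine hull lifts into the span of [b], so it lies in the cone and
    thus in the dilate. *)
Lemma relint_dilate (R : realType) (d k : nat) (s : seq 'rV[R]_d)
    (b : seq 'rV[R]_(d + 1)) (g : 'rV[R]_(d + 1) -> R) q :
  convex_hull [set` s] !=set0 ->
  basis_of (span (undup (map (homog 1) s))) b ->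
  {subset b <= map (homog 1) s} -> {in b, forall w, 0 < g w} ->
  homog k%:R q = \sum_(w <- b) g w *: w ->
  relint (dilate k (convex_hull [set` s])) q.
Proof.
move=> s0 bb bs g0 qE; have fb := basis_free bb.
have coordE (c : 'rV[R]_(d + 1) -> R) (i : 'I_(size b)) :
    coord (in_tuple b) i (\sum_(w <- b) c w *: w) = c b`_i.
  by rewrite (big_nth 0) big_mkord (coord_sum_free (fun j => c b`_j)).
split.
  by apply: (cone_hull s0 bs _ qE) => w /g0/ltW.
have pos : \forall y \near q, forall i : 'I_(size b),
    0 < coord (in_tuple b) i (homog k%:R y).
  suff posi (i : 'I_(size b)) :
      \forall y \near q, 0 < coord (in_tuple b) i (homog k%:R y).
    exact: (filter_forall (nbhs_filter q) posi).
  have fc := @homog_functional_continuous R d k%:R (coord (in_tuple b) i) q.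
  apply: (cvgr_gt _ fc).
  rewrite qE; apply: (eq_ind_r (fun t => 0 < t) _ (coordE g i)).
  exact/g0/mem_nth.
rewrite near_withinE; apply: filterS pos => y posy /affine_hull_dilate.
rewrite -(span_basis bb) => /(free_span fb)[c yE _].
apply: (cone_hull s0 bs _ yE) => w wb.
have wi : (index w b < size b)%N by rewrite index_mem.
have := posy (Ordinal wi); rewrite yE coordE /= nth_index //.
exact: ltW.
Qed.

(** The lift of [x + U] is spanned by the lift of [x] and a basis of [U] at height 0, which makes
    [n.+1] vectors. *)
Lemma dim_homog_span (R : realType) (d n : nat) (s : seq 'rV[R]_d) :
  has_dim (convex_hull [set` s]) n ->
  (\dim (span (undup (map (homog 1) s))) <= n.+1)%N.
Proof.
move=> [x [U [dimU hU]]].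
pose e := homog 1 x :: map (homog 0) (vbasis U).
suff /dimvS/leq_trans : (span (undup (map (homog 1) s)) <= span e)%VS.
  by apply; apply: leq_trans (dim_span _) _; rewrite /= size_map size_tuple dimU.
apply/span_subvP => _ /[!mem_undup] /mapP[v vs ->].
have : affine_hull (convex_hull [set` s]) v by do 2 apply: sub_gen_smallest.
rewrite hU => -[u /= uU <-].
have -> : homog 1 (x + u) = homog 1 x + homog 0 u by rewrite homogD addr0.
apply: memvD; first by rewrite memv_span ?mem_head.
rewrite (coord_vbasis uU).
have -> : homog 0 (\sum_(i < \dim U) coord (vbasis U) i u *: (vbasis U)`_i) =
    \sum_(i < \dim U) coord (vbasis U) i u *: homog 0 (vbasis U)`_i.
  under [in RHS]eq_bigr do rewrite homogZ mulr0.
  by rewrite homog_sum big1_eq.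
apply: memv_suml => i _; apply/memvZ/memv_span.
by rewrite inE map_f ?orbT // mem_nth // size_tuple.
Qed.

(** * The main argument *)

Lemma rpoly_no_interior (R : realType) (d : nat) (L P : set 'rV[R]_d) :
  no_interior_upto L P (rpoly L P).
Proof.
(* For the default value 0 of [xget] the range of [k] is empty. *)
rewrite /rpoly; case: xgetP => [r _ [//]|_ k].
by case: k.
Qed.

Theorem corollary1p4 (R : realType) (d : nat) (L : set 'rV[R]_d)
    (P : set 'rV[R]_d) (n : nat)
    (hL : is_lattice L) (hP : lattice_polytope L P) (hn : has_dim P n) :
  normal_polytope L (dilate (n - rpoly L P) P).
Proof.
move: hP => [V [/finite_seqP[s ->] sL PE]].
set k := (n - rpoly L P)%N => m x m1 Lx [_ [p Pp <-] xE].
have P0 : P !=set0 by exists p.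
have cP : convex_set P by rewrite PE; apply: convex_hull_convex.
have := Pp; rewrite {1}PE => /hull_cone[c [c0 pE]].
set h := undup (map (homog 1) s) in pE.
have [b [e [bb bs e0 sume]]] :
  exists (b : seq 'rV[R]_(d + 1)) (e : 'rV[R]_(d + 1) -> R),
    [/\ basis_of (span h) b, {subset b <= h}, {in b, forall w, 0 <= e w} &
      \sum_(w <- h) c w *: w = \sum_(w <- b) e w *: w].
  exact: conic_caratheodory (undup_uniq _) (fun w _ => c0 w).
rewrite sume in pE.
have bs1 : {subset b <= map (homog 1) s} by move=> w /bs; rewrite mem_undup.
have Nn : (size b <= n.+1)%N.
  by rewrite -(size_basis (X := in_tuple b) bb); apply: dim_homog_span; rewrite -PE.
pose lam w := (m * k)%:R * e w.
have lam0 : {in b, forall w, 0 <= lam w} by move=> w /e0 ew; rewrite mulr_ge0.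
have hx : homog (m * k)%:R x = \sum_(w <- b) lam w *: w.
  rewrite -xE scalerA -natrM -[X in homog X _]mulr1 -homogZ pE scaler_sumr.
  by apply: eq_bigr => w _; rewrite scalerA.
pose t w := Num.truncn (lam w); pose f w := lam w - (t w)%:R.
have f0 : {in b, forall w, 0 <= f w}.
  by move=> w /lam0 lw; rewrite subr_ge0; case/andP: (truncn_itv lw).
(* Strict even where [lam w] is 0: every element of the basis gets positive weight, as
   [relint_dilate] requires. *)
have f1 : {in b, forall w, 0 < 1 - f w}.
  move=> w /lam0 lw; case/andP: (truncn_itv lw) => _.
  by rewrite -natr1 /f /t => ?; lra.
pose T := (\sum_(w <- b) t w)%N.
(* Equality of heights says that the [lam w] add up to [m * k], so the fractional parts have an
   integral sum. *)
move: hx; rewrite (homog_comb _ bs1) => /homog_inj[sumlam xsum].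
have sumf : \sum_(w <- b) f w = (m * k)%:R - T%:R.
  by rewrite sumrB -sumlam natr_sum.
have Tmk : (T <= m * k)%N.
  by rewrite -(ler_nat R) -subr_ge0 -sumf big_seq sumr_ge0.
pose S := (m * k - T)%N.
have SE : \sum_(w <- b) f w = S%:R by rewrite sumf natrB.
have sum1f : \sum_(w <- b) (1 - f w) = (size b)%:R - S%:R.
  by rewrite sumrB SE big_const_seq count_predT iter_addr addr0.
(* The lift of [p] has height 1, so it is not an empty sum. *)
have b0 : b != [::].
  apply/eqP => be; move: pE; rewrite be big_nil -(scale0r (homog 1 p)) homogZ.
  by move=> /homog_inj[/eqP]; rewrite mul0r oner_eq0.
(* The sum of the positive numbers [1 - f w] is [size b - S], so this factor is at least 1, as
   [no_interior_upto] demands. *)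
have SN : (S < size b)%N.
  rewrite -(ltr_nat R) -subr_gt0 -sum1f.
  case: (b) b0 f1 => // w b' _ f1; rewrite big_cons ltr_wpDr ?f1 ?mem_head //.
  rewrite big_seq sumr_ge0 // => u ub; rewrite ltW // f1 //.
  by rewrite inE ub orbT.
(* Each vertex is listed with the integral part of its coefficient as multiplicity. *)
pose w0 := flatten [seq nseq (t w) (lsubmx w) | w <- b].
have LPb : {in b, forall w, L (lsubmx w) /\ P (lsubmx w)}.
  move=> w /bs1/mapP[v vs ->]; rewrite row_mxKl; split; first exact: sL.
  by rewrite PE; apply: sub_gen_smallest.
have LPw : {in w0, forall v, L v /\ P v}.
  move=> v /flattenP[_ /mapP[w wb ->]] /nseqP[-> _]; exact: LPb.
have sumw : \sum_(v <- w0) v = \sum_(w <- b) (t w)%:R *: lsubmx w.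
  rewrite /w0 big_flatten big_map; apply: eq_bigr => w _.
  by rewrite big_nseq iter_addr addr0 scaler_nat.
have szw : size w0 = T.
  rewrite size_flatten /shape -map_comp sumnE big_map.
  by apply: eq_bigr => w _; rewrite /= size_nseq.
pose y := \sum_(w <- b) f w *: lsubmx w.
have xy : x = y + \sum_(v <- w0) v.
  rewrite sumw xsum -big_split; apply: eq_bigr => w _ /=.
  by rewrite -scalerDl subrK.
have LB := (lattice0B hL).2.
have Lw : L (\sum_(v <- w0) v) by apply: lattice_sum => // v /LPw[].
have Ly : L y by rewrite -[y](addrK (\sum_(v <- w0) v)) -xy; apply: LB.
have hy : homog S%:R y = \sum_(w <- b) f w *: w.
  by rewrite (homog_comb _ bs1) SE.
have Py : dilate S P y.
  by rewrite PE; apply: (cone_hull _ bs1 f0 hy); rewrite -PE.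
have Sk : (S <= k)%N.
  pose q := \sum_(w <- b) (1 - f w) *: lsubmx w.
  (* [q] is the sum of all vertices in [b] minus the lattice point [y]. *)
  have Lq : L q.
    rewrite /q; under eq_bigr do rewrite scalerBl scale1r.
    rewrite sumrB; apply: LB => //.
    rewrite -(big_map lsubmx xpredT id); apply: lattice_sum => // v /mapP[w wb ->].
    exact: (LPb w wb).1.
  have Iq : relint (dilate (size b - S) P) q.
    rewrite PE; apply: (relint_dilate _ bb bs1 f1); first by rewrite -PE.
    by rewrite (homog_comb _ bs1) sum1f natrB // ltnW.
  have := @rpoly_no_interior R d L P (size b - S)%N.
  (* If [size b - S] exceeds [rpoly L P], then [size b <= n.+1] gives [S <= k]; otherwise [q] is a
     forbidden interior lattice point. *)
  case: (leqP (size b - S)%N (rpoly L P)) => [_|lt_r _]; last first.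
    by move: lt_r Nn SN; rewrite /k; move: (size b) (rpoly L P) (S) => N r j; lia.
  rewrite subn_gt0 SN => /(_ isT)/seteqP[/(_ q)].
  by case.
have szmk : (S + size w0 = m * k)%N by rewrite szw subnK.
move: m1 szmk; rewrite xy; case: (m) => // m' _ szmk.
exact: (dilate_regroup hL cP P0 Sk Ly Py LPw szmk).
Qed.
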